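(* Let $t>0$ be an integer. There is a constant $C_t$ such that the following holds. Let $P$ be an $x$-monotone simple polygon and let $V$ be a set of $n$ points on its boundary. If the visibility graph of $V$ with respect to $P$ does not contain $K_{t,t}$ as a subgraph, then it has at most $C_t n$ edges.
   Context: A simple polygon is $x$-monotone if every vertical line intersects its boundary at most twice. Two points $p,q\in P$ see each other if the segment $\overline{pq}$ is disjoint from the exterior of $P$. The visibility graph of a set $V$ of points on the boundary of $P$ with respect to $P$ has vertex set $V$, with two points adjacent iff they see each other. *)

(* Defs.v *)
From HB Require Import structures.
From mathcomp Require Import all_boot all_order all_algebra.
From mathcomp Require Import all_classical all_reals all_analysis.

Set Implicit Arguments.
Unset Strict Implicit.
Unset Printing Implicit Defensive.

Import Order.TTheory GRing.Theory Num.Theory numFieldNormedType.Exports.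
Local Open Scope ring_scope.
Local Open Scope classical_set_scope.

Section Polygons.
Variable R : realType.
Notation pt := (R * R)%type.

Definition segment (a b : pt) : set pt :=
  [set z | exists2 l : R, 0 <= l <= 1 &
     z = ((1 - l) * a.1 + l * b.1, (1 - l) * a.2 + l * b.2)].

Definition vertex (p : seq pt) (i : nat) : pt := nth (0, 0) p (i %% size p).
Definition pedge (p : seq pt) (i : nat) : set pt :=
  segment (vertex p i) (vertex p i.+1).

Definition simple_polygon (p : seq pt) : Prop :=
  [/\ (3 <= size p)%N, uniq p,
      (forall i, (i < size p)%N -> pedge p i `&` pedge p i.+1 = [set vertex p i.+1])
    & (forall i j, (i < size p)%N -> (j < size p)%N -> i != j ->
         j != (i.+1 %% size p)%N -> i != (j.+1 %% size p)%N ->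
         pedge p i `&` pedge p j = set0)].

Definition pboundary (p : seq pt) : set pt :=
  \bigcup_(i in [set i : nat | (i < size p)%N]) pedge p i.

(* exterior of the polygon: the unbounded connected component of the
   complement of the boundary, i.e. the points from which one can travel,
   along a continuous path avoiding the boundary, arbitrarily far away. *)
Definition pexterior (p : seq pt) : set pt :=
  [set q | ~ pboundary p q /\
     forall M : R, exists g : R -> pt,
       [/\ continuous g, g 0 = q, M < `|(g 1).1| + `|(g 1).2|
         & forall s : R, 0 <= s <= 1 -> ~ pboundary p (g s)]].

Definition pregion (p : seq pt) : set pt := ~` pexterior p.

Definition x_monotone (p : seq pt) : Prop :=
  forall c : R, forall a b d : pt,
    pboundary p a -> pboundary p b -> pboundary p d ->
    a.1 = c -> b.1 = c -> d.1 = c -> [\/ a = b, a = d | b = d].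

Definition sees (p : seq pt) (a b : pt) : Prop :=
  segment a b `&` pexterior p = set0.

Local Close Scope classical_set_scope.

(* edge set of the visibility graph of V = {v i | i < n} (v injective);
   edges are unordered pairs, encoded as (i, j) with i < j *)
Definition vis_edges (p : seq pt) (n : nat) (v : 'I_n -> pt) : {set 'I_n * 'I_n} :=
  [set e : 'I_n * 'I_n | (e.1 < e.2)%N && `[< sees p (v e.1) (v e.2) >]].

Definition contains_Ktt (p : seq pt) (n : nat) (v : 'I_n -> pt) (t : nat) : Prop :=
  exists A B : {set 'I_n}, [/\ #|A| = t, #|B| = t, [disjoint A & B]
    & forall a b, a \in A -> b \in B -> sees p (v a) (v b)].

End Polygons.

(* Main.v *)
Require Import Defs.
From HB Require Import structures.
From mathcomp Require Import all_boot all_order all_algebra.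
From mathcomp Require Import all_classical all_reals all_analysis.
From mathcomp Require Import fintype finset zify lra.
Set Implicit Arguments.
Unset Strict Implicit.
Unset Printing Implicit Defensive.
Import Order.TTheory GRing.Theory Num.Theory numFieldNormedType.Exports.
Local Open Scope ring_scope.

(**
  In a polygon met at most twice by every vertical line, a point lies outside
  the exterior iff there are boundary points both below and above it on its
  vertical line, and every boundary point is a floor point or a ceiling point.
  Visibility then means that a segment stays above the floor and below the
  ceiling, and comparing slopes gives two closure rules.
  - Ceiling against floor, ceiling point to the left: if [u < u' <= l < l'],
    [u] sees [l] and [u'] sees [l'], then [u'] sees [l]. (The mirror image
    holds when the ceiling point is on the right.)
  - Floor against floor: if [a < b < c < d], [a] sees [c] and [b] sees [d],
    then the floor does not block [ad]; and the ceiling does not block it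
    either as soon as [a] and [d] lie under a common visibility segment.
    (Dually for the ceiling.)

  Under the first rule, discard every edge close, in the neighbour order of one
  of its ends, to an edge with few continuations on the other end; this costs
  linearly many edges. If an edge [(c, a)] survives, let [y] be the [t]-th next
  neighbour of [c] after [a] and [D] the [t] neighbours of [a] preceding [c]:
  either [D] and the next [t] neighbours of [c] form a [K_{t,t}], or some [d]
  in [D] does not see [y]; but [d] has a neighbour beyond [y] and [y] has one
  before [d], so the rule forces [d] to see [y].

  Under the second rule, cut the points into consecutive blocks such that all
  pairs in a block lie under a common edge and edges only join equal or
  consecutive blocks. Edges inside blocks are counted by discarding the [t]
  longest ones at either end of each point; edges between consecutive blocks
  satisfy the first rule with the roles of left and right ends exchanged.
*)

(** * Counting edges in ordered graphs *)

Lemma card_bigcup_le (I T : finType) (P : pred I) (F : I -> {set T}) :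
  (#|\bigcup_(i | P i) F i| <= \sum_(i | P i) #|F i|)%N.
Proof.
elim/big_rec2: _ => [|i n A _ leAn]; first by rewrite cards0.
by rewrite (leq_trans (leq_card_setU _ _)) ?leq_add2l.
Qed.

Lemma card_pairs (I J : finType) (Q : I -> J -> bool) :
  #|[set p : I * J | Q p.1 p.2]| = (\sum_i #|[set j | Q i j]|)%N.
Proof.
under eq_bigr do rewrite -sum1dep_card.
by rewrite -sum1dep_card pair_big_dep /=.
Qed.

Lemma card_pairs_le (I J : finType) (Q : I -> J -> bool) (m : nat) :
  (forall i, #|[set j | Q i j]| <= m)%N ->
  (#|[set p : I * J | Q p.1 p.2]| <= m * #|I|)%N.
Proof.
move=> le_m; rewrite card_pairs mulnC -sum_nat_const.
exact: leq_sum.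
Qed.

Lemma card_pairs_swap (I J : finType) (Q : I -> J -> bool) :
  #|[set p : I * J | Q p.1 p.2]| = #|[set p : J * I | Q p.2 p.1]|.
Proof.
rewrite (card_pairs (fun j i => Q i j)) card_pairs.
under eq_bigr do rewrite -sum1dep_card.
under [RHS]eq_bigr do rewrite -sum1dep_card.
by rewrite (exchange_big_dep predT).
Qed.

Lemma card_pairs_le_r (I J : finType) (Q : I -> J -> bool) (m : nat) :
  (forall j, #|[set i | Q i j]| <= m)%N ->
  (#|[set p : I * J | Q p.1 p.2]| <= m * #|J|)%N.
Proof.
move=> le_m; rewrite card_pairs_swap.
exact: (card_pairs_le (Q := fun j i => Q i j)).
Qed.

Lemma card_subset_eq (T : finType) (S : {set T}) (m : nat) :
  (m <= #|S|)%N -> exists2 A : {set T}, A \subset S & #|A| = m.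
Proof.
elim: m => [|m IHm] lemS; first by exists set0; rewrite ?sub0set ?cards0.
have [A sAS cardA] := IHm (ltnW lemS).
have /properP[_ [x Sx nAx]] : A \proper S by rewrite properEcard sAS cardA.
exists (x |: A); last by rewrite cardsU1 nAx cardA.
by rewrite subUset sub1set Sx.
Qed.

(** * Elements of bounded rank in a finite ordered set *)

Section RankBounds.
Variables (R : realDomainType) (T : finType) (k : T -> R).

(** If more than [m] elements qualified, the one of least key would have at least [m] others above
    it. *)
Lemma card_few_above (S : {set T}) (m : nat) :
  {in S &, injective k} ->
  (#|[set x in S | #|[set y in S | (k x < k y)%R]| < m]| <= m)%N.
Proof.
move=> injk; set M := [set x in S | _]; case: leqP => // ltmM.
have /card_gt0P[x0 Mx0] : (0 < #|M|)%N by apply: leq_ltn_trans ltmM.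
case: (arg_minP k Mx0) => x Mx minx.
have Mx' : x \in M by []; move: (Mx'); rewrite inE => /andP[Sx].
rewrite ltnNge => /negP[].
rewrite -ltnS (leq_trans ltmM) // (cardsD1 x M) Mx' ltnS subset_leq_card //.
apply/subsetP => y; rewrite !inE => /andP[neyx /andP[Sy cy]].
rewrite Sy lt_neqAle minx ?andbT; last by rewrite [_ y]inE Sy.
by apply: contraNneq neyx => /injk ->.
Qed.

Lemma exists_threshold (S : {set T}) (m : nat) :
  {in S &, injective k} -> (0 < m <= #|S|)%N ->
  exists2 x, x \in S & #|[set y in S | k y <= k x]| = m.
Proof.
move=> injk; case: m => // m /=; elim: m => [|m IHm] lemS.
  have [x0 Sx0] := card_gt0P lemS.
  case: (arg_minP k Sx0) => x Sx minx; exists x => //.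
  apply/eqP/cards1P; exists x; apply/setP=> y; rewrite !inE.
  apply/andP/eqP => [[Sy lyx]|-> //]; apply: injk => //.
  by apply/eqP; rewrite eq_le lyx minx.
have [x Sx cardx] := IHm (ltnW lemS).
set A := [set y in S | k y <= k x] in cardx.
have sAS : A \subset S by apply/subsetP=> y; rewrite inE => /andP[].
have /properP[_ [y0 Sy0 nAy0]] : A \proper S by rewrite properEcard sAS cardx.
pose P y := (y \in S) && (k x < k y).
have Py0 : P y0.
  by rewrite /P Sy0 ltNge; move: nAy0; rewrite inE Sy0.
case: (arg_minP (P := P) k Py0) => y /andP[Sy ltxy] miny; exists y => //.
have <- : #|y |: A| = m.+2 by rewrite cardsU1 cardx inE Sy leNgt ltxy.
congr #|pred_of_set _|; apply/setP => z; rewrite !inE.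
apply/andP/orP => [[Sz lezy]|[/eqP-> //|/andP[Sz lezx]]].
  case: (leP (k z) (k x)) => [|ltxz]; first by rewrite Sz; right.
  left; apply/eqP/injk => //; apply/eqP; rewrite eq_le lezy.
  by apply: miny; rewrite /P Sz.
by split=> //; apply: le_trans (ltW ltxy).
Qed.

End RankBounds.

(** * Charging edges to edges with few continuations *)

Section SparseEdges.
Variables (R : realDomainType) (I J : finType) (kI : I -> R) (kJ : J -> R).
Variables (E : I -> J -> bool) (t : nat).
Hypothesis injI : forall j x y, E x j -> E y j -> kI x = kI y -> x = y.
Hypothesis injJ : forall i x y, E i x -> E i y -> kJ x = kJ y -> x = y.

(** The edge [(c, a)] is charged to an edge [(c, a')], at most [t] neighbours of [c] further on,
    whose end [a'] has at most [t] neighbours before [c]. *)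
Definition near_sparse (c : I) (a : J) : bool :=
  [&& E c a & [exists a', [&& E c a', kJ a <= kJ a',
     (#|[set y | E c y & (kJ a < kJ y <= kJ a')%R]| <= t)%N &
     (#|[set x | E x a' & (kI x < kI c)%R]| <= t)%N]]].

Lemma card_near_sparse :
  (#|[set p : I * J | near_sparse p.1 p.2]| <= t.+1 * (t.+1 * #|J|))%N.
Proof.
(* At most [t.+1 * #|J|] edges [(c, a')] have few earlier neighbours, and each
   of them accounts for at most [t.+1] near-sparse edges [(c, a)]. *)
pose S c a := E c a && (#|[set x | E x a & (kI x < kI c)%R]| <= t)%N.
pose F (p : I * J) := [set q : I * J | (q.1 == p.1) &&
  [&& E p.1 q.2, kJ q.2 <= kJ p.2 &
     (#|[set y | E p.1 y & (kJ q.2 < kJ y <= kJ p.2)%R]| <= t)%N]].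
have sub : [set p : I * J | near_sparse p.1 p.2] \subset
           \bigcup_(p : I * J | S p.1 p.2) F p.
  apply/subsetP => -[c a]; rewrite inE /= => /andP[Eca /existsP[a']].
  case/and4P=> Eca' leaa' few1 few2; apply/bigcupP; exists (c, a') => /=.
    by rewrite /S Eca' few2.
  by rewrite inE /= eqxx Eca leaa' few1.
apply: leq_trans (subset_leq_card sub) _.
apply: leq_trans (card_bigcup_le _ _) _.
apply: (@leq_trans (\sum_(p : I * J | S p.1 p.2) t.+1)%N); last first.
  rewrite sum_nat_cond_const mulnC leq_mul2l; apply/orP; right.
  apply: card_pairs_le_r => a.
  have /(card_few_above t.+1) : {in [set x | E x a] &, injective (fun x => - kI x)}.
    by move=> x y; rewrite !inE => Ex Ey /oppr_inj; apply: injI Ex Ey.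
  congr (_ <= _)%N; congr #|pred_of_set _|; apply/setP => x.
  rewrite !inE /S ltnS; congr (_ && (_ <= _)%N).
  by congr #|pred_of_set _|; apply/setP => y; rewrite !inE ltrN2.
apply: leq_sum => -[c a'] /andP[/= Eca' _].
pose S' := [set y | E c y & kJ y <= kJ a'].
have /(card_few_above t.+1) lecard : {in S' &, injective kJ}.
  by move=> x y; rewrite !inE => /andP[Ex _] /andP[Ey _]; apply: injJ Ex Ey.
have injp : injective (fun y : J => (c, y)) by move=> x y [].
apply: leq_trans lecard; rewrite -(card_imset _ injp) subset_leq_card //.
apply/subsetP => -[c' a]; rewrite inE /= => /andP[/eqP-> /and3P[Eca leaa few]].
apply: imset_f; rewrite !inE Eca leaa /= ltnS; apply: leq_trans few.
rewrite subset_leq_card //; apply/subsetP=> y; rewrite !inE.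
by case/andP=> /andP[-> ->] ->.
Qed.

End SparseEdges.

(** * Relations closed under the first crossing rule *)

Section CrossingClosed.
Variables (R : realDomainType) (I J : finType) (kI : I -> R) (kJ : J -> R).
Variables (E : I -> J -> bool) (t : nat).
Hypothesis t_gt0 : (0 < t)%N.
Hypothesis injI : forall x y j j', E x j -> E y j' -> kI x = kI y -> x = y.
Hypothesis injJ : forall x y i i', E i x -> E i' y -> kJ x = kJ y -> x = y.
(** The third edge links the two key functions: depending on the use, it places [x'] on the correct
    side of [y] or is an edge under which both lie. *)
Hypothesis crossE : forall x x' x'' y y' y'',
  E x y -> E x' y' -> E x'' y'' ->
  kI x < kI x' <= kI x'' -> kJ y'' <= kJ y < kJ y' -> E x' y.
Hypothesis Ktt_free : ~ exists A : {set I}, exists B : {set J},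
  [/\ #|A| = t, #|B| = t & forall a b, a \in A -> b \in B -> E a b].

Let sparseR := near_sparse kI kJ E t.
(** Exchanging the two sides and negating both keys lets one counting lemma serve both ends. *)
Let sparseL c a := near_sparse (fun y => - kJ y) (fun x => - kI x)
  (fun y x => E x y) t a c.

Lemma edge_sparse c a : E c a -> sparseR c a || sparseL c a.
Proof.
move=> Eca; apply: contraT; rewrite negb_or => /andP[].
rewrite /sparseR /sparseL /near_sparse !Eca /= => /existsPn densR /existsPn densL.
have dR a' : E c a' -> kJ a <= kJ a' ->
    (#|[set y | E c y & (kJ a < kJ y <= kJ a')%R]| <= t)%N ->
    (t < #|[set x | E x a' & (kI x < kI c)%R]|)%N.
  by move=> Eca' le few; move: (densR a'); rewrite Eca' le few /= -ltnNge.
have dL d : E d a -> kI d <= kI c ->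
    (#|[set x | E x a & (kI d <= kI x < kI c)%R]| <= t)%N ->
    (t < #|[set y | E d y & (kJ a < kJ y)%R]|)%N.
  move=> Eda le few; move: (densL d); rewrite Eda lerN2 le /=.
  have -> : [set x | E x a & (- kI c < - kI x <= - kI d)%R] =
            [set x | E x a & (kI d <= kI x < kI c)%R].
    by apply/setP=> x; rewrite !inE ltrN2 lerN2 (andbC (_ < _)).
  rewrite few /= -ltnNge.
  have -> // : [set x | E d x & (- kJ x < - kJ a)%R] = [set y | E d y & (kJ a < kJ y)%R].
  by apply/setP=> x; rewrite !inE ltrN2.
have t_R : (t < #|[set y | E c y & (kJ a < kJ y)%R]|)%N.
  apply: dL => //; rewrite (_ : [set x | _] = set0) ?cards0 //.
  by apply/setP=> x; rewrite !inE; case: ltgtP; rewrite ?andbF.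
have t_L : (t < #|[set x | E x a & (kI x < kI c)%R]|)%N.
  apply: dR => //; rewrite (_ : [set x | _] = set0) ?cards0 //.
  by apply/setP=> x; rewrite !inE; case: ltgtP; rewrite ?andbF.
have injR : {in [set y | E c y & (kJ a < kJ y)%R] &, injective kJ}.
  by move=> x y; rewrite !inE => /andP[Ex _] /andP[Ey _]; apply: injJ Ex Ey.
have injL : {in [set x | E x a & (kI x < kI c)%R] &, injective (fun x => - kI x)}.
  move=> x y; rewrite !inE => /andP[Ex _] /andP[Ey _] /oppr_inj.
  exact: injI Ex Ey.
have [|at_] := exists_threshold injR (m := t); first by rewrite t_gt0 ltnW.
rewrite inE => /andP[Ecat lt_a_at] cardA.
(* Rank [t.+1] here: the [t] elements of [D] lie strictly between [dl] and [c], and [dl] stays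
   available as a neighbour of [a] to the left of them all. *)
have [|dl] := exists_threshold injL (m := t.+1); first by rewrite t_L.
rewrite inE => /andP[Edla lt_dl_c] cardD.
pose A := [set y | E c y & (kJ a < kJ y <= kJ at_)%R].
pose D := [set x | E x a & (kI dl < kI x < kI c)%R].
have cA : #|A| = t.
  rewrite -[RHS]cardA; congr #|pred_of_set _|; apply/setP=> y.
  by rewrite !inE andbA.
have cD : #|D| = t.
  apply: succn_inj; rewrite -[RHS]cardD.
  have <- : #|dl |: D| = #|D|.+1 by rewrite cardsU1 !inE ltxx !andbF.
  congr #|pred_of_set _|; apply/setP=> x; rewrite !inE lerN2.
  apply/orP/andP => [[/eqP->|]|[/andP[Ex ltxc]]]; first by rewrite Edla lt_dl_c lexx.
    by case/and3P=> -> /ltW -> ->.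
  rewrite le_eqVlt => /predU1P[eqk|lt].
    by rewrite (injI Ex Edla (esym eqk)) eqxx; left.
  by right; rewrite Ex lt.
have AE y : y \in A -> [/\ E c y, kJ a < kJ y & kJ y <= kJ at_].
  by rewrite inE => /and3P[].
(* Each of the next [t] neighbours of [c] sees at least as far left as [dl]:
   otherwise all its left neighbours would be among the [t] points of [D]. *)
have far y : y \in A -> exists2 x, E x y & kI x <= kI dl.
  move=> Ay; have [Ecy ltay leyat] := AE y Ay.
  have few : (#|[set z | E c z & (kJ a < kJ z <= kJ y)%R]| <= t)%N.
    rewrite -cA subset_leq_card //; apply/subsetP=> z; rewrite !inE.
    by case/and3P=> -> -> /= /le_trans; apply.
  have := dR y Ecy (ltW ltay) few; rewrite -[X in (X < _)%N]cD => ltD.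
  have /subsetPn[x] : ~~ ([set x | E x y & (kI x < kI c)%R] \subset D).
    by apply: contraL ltD => /subset_leq_card; rewrite -leqNgt.
  rewrite !inE => /andP[Exy ltxc] nDx; exists x => //; rewrite leNgt.
  apply: contra nDx => ltdx; rewrite ltdx ltxc !andbT.
  by apply: (crossE Edla Exy Eca); rewrite ?ltdx ?(ltW ltxc) ?lexx.
have Aat : at_ \in A by rewrite inE Ecat lt_a_at lexx.
have [lat Elat le_lat] := far _ Aat.
(* If all of [D] sees [at_], crossing these edges with the far edges at each [y] in [A] completes a
   [K_{t,t}]. *)
have [/subsetP sDat|/subsetPn[d Dd nEd]] := boolP (D \subset [set x | E x at_]).
  case: Ktt_free; exists D, A; split=> // x y Dx Ay.
  have [Ecy ltay leyat] := AE y Ay.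
  have := sDat x Dx; rewrite inE => Exat.
  have [xy Exy lexy] := far y Ay.
  move: leyat; rewrite le_eqVlt => /predU1P[eqk|lty].
    by rewrite (injJ Ecy Ecat eqk).
  move: Dx; rewrite inE => /and3P[Exa ltdx ltxc].
  apply: (crossE Exy Exat Ecy); last by rewrite lexx.
  by rewrite (ltW ltxc) (le_lt_trans lexy).
move: Dd nEd; rewrite !inE => /and3P[Eda ltdld ltdc] /negP[].
have few : (#|[set x | E x a & (kI d <= kI x < kI c)%R]| <= t)%N.
  rewrite -[X in (_ <= X)%N]cD subset_leq_card //; apply/subsetP=> z; rewrite !inE.
  by case/and3P=> -> /(lt_le_trans ltdld) -> ->.
(* Having more than [t] neighbours after [a], [d] has one outside [A]; the rule puts it beyond
   [at_]. *)
have := dL d Eda (ltW ltdc) few; rewrite -[X in (X < _)%N]cA => ltA.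
have /subsetPn[b] : ~~ ([set y | E d y & (kJ a < kJ y)%R] \subset A).
  by apply: contraL ltA => /subset_leq_card; rewrite -leqNgt.
rewrite !inE => /andP[Edb ltab]; rewrite ltab /= => nAb.
have ltatb : kJ at_ < kJ b.
  rewrite ltNge; apply: contra nAb => leb; rewrite leb andbT.
  move: leb; rewrite le_eqVlt => /predU1P[eqk|ltb].
    by rewrite (injJ Edb Ecat eqk).
  by apply: (crossE Edb Ecat Eca); rewrite ?ltdc ?lexx ?ltb ?(ltW ltab).
by apply: (crossE Elat Edb Ecat); rewrite ?lexx ?ltatb ?(ltW ltdc) ?(le_lt_trans le_lat).
Qed.

Lemma card_crossing_closed :
  (#|[set p : I * J | E p.1 p.2]| <= t.+1 * (t.+1 * (#|I| + #|J|)))%N.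
Proof.
have sub : [set p : I * J | E p.1 p.2] \subset
    [set p : I * J | sparseR p.1 p.2] :|: [set p : I * J | sparseL p.1 p.2].
  by apply/subsetP => -[c a]; rewrite !inE /= => /edge_sparse.
apply: leq_trans (subset_leq_card sub) _.
apply: leq_trans (leq_card_setU _ _) _.
rewrite addnC 2!mulnDr leq_add // /sparseR.
  rewrite card_pairs_swap.
  apply: (card_near_sparse (kI := fun y => - kJ y) (kJ := fun x => - kI x)
    (E := fun y x => E x y)).
    by move=> i x y Ex Ey /oppr_inj; apply: injJ Ex Ey.
  by move=> j x y Ex Ey /oppr_inj; apply: injI Ex Ey.
by apply: card_near_sparse => [j x y Ex Ey|i x y Ex Ey]; [apply: injI Ex Ey | apply: injJ Ex Ey].
Qed.
End CrossingClosed.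

(** * Relations closed under nested crossing, and blocks *)

Section NestedCrossing.
Variables (R : realDomainType) (T : finType) (k : T -> R).
Variables (E : T -> T -> bool) (t : nat).
Hypothesis t_gt0 : (0 < t)%N.
Hypothesis ltE : forall a d, E a d -> k a < k d.
Hypothesis injl : forall a b c d, E a c -> E b d -> k a = k b -> a = b.
Hypothesis injr : forall a b c d, E a c -> E b d -> k c = k d -> c = d.
Hypothesis crossE : forall a b c d e f, E a c -> E b d -> E e f ->
  k e <= k a < k b -> k b < k c -> k c < k d <= k f -> E a d.
Hypothesis Ktt_free : ~ exists A B : {set T},
  [/\ #|A| = t, #|B| = t & forall a b, a \in A -> b \in B -> E a b].

Let G a d := [exists e, exists f, [&& E e f, k e <= k a & k d <= k f]].

Let G_nested a b c d : G a d -> k a <= k b -> k c <= k d -> G b c.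
Proof.
move=> /existsP[e /existsP[f /and3P[Eef ea df]]] ab cd.
apply/existsP; exists e; apply/existsP; exists f.
by rewrite Eef (le_trans ea ab) (le_trans cd df).
Qed.

(** Each link forces a block boundary between its two points, so the length of a longest chain
    ending at [v] can number the block of [v]. *)
Fixpoint chain_to m v :=
  if m is m'.+1 then [exists u, [&& k u < k v, ~~ G u v & chain_to m' u]]
  else true.

Let chain_le m v w : k v <= k w -> chain_to m v -> chain_to m w.
Proof.
case: m => //= m vw /existsP[u /and3P[uv nG cu]]; apply/existsP; exists u.
rewrite (lt_le_trans uv vw) cu andbT /=.
by apply: contra nG => /G_nested; apply.
Qed.

(** Keys strictly decrease along a chain; this bounds its length, so a longest one exists. *)
Let chain_card m v : chain_to m v -> (m <= #|[set u | (k u < k v)%R]|)%N.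
Proof.
elim: m v => //= m IHm v /existsP[u /and3P[uv _ /IHm leu]].
apply: leq_ltn_trans leu _; apply: proper_card; apply/properP; split.
  by apply/subsetP=> x; rewrite !inE => /lt_trans; apply.
by exists u; rewrite inE ?ltxx.
Qed.

Let chain_bound v m : chain_to m v -> (m <= #|T|)%N.
Proof. by move/chain_card => le; apply: leq_trans le (max_card _). Qed.

Let chain0 v : exists m, chain_to m v. Proof. by exists 0%N. Qed.

(* Counting the links of a longest chain of pairs lying under no common edge
   makes any two points of one block lie under a common edge, while no edge
   skips a block. *)
Definition block v := ex_maxn (chain0 v) (@chain_bound v).

Let blockP v : chain_to (block v) v.
Proof. by rewrite /block; case: ex_maxnP. Qed.

Let block_max v m : chain_to m v -> (m <= block v)%N.
Proof. by rewrite /block; case: ex_maxnP => i _ max /max. Qed.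

Let block_le v w : k v <= k w -> (block v <= block w)%N.
Proof. by move=> vw; apply/block_max/(chain_le vw)/blockP. Qed.

(** Otherwise the pair would add a link to a longest chain at [a], giving [d] a larger block
    number. *)
Let block_eq_G a d : k a < k d -> block a = block d -> G a d.
Proof.
move=> ad eqb; apply: contraT => nG; have : chain_to (block a).+1 d.
  by apply/existsP; exists a; rewrite ad nG /=.
by move/block_max; rewrite eqb ltnn.
Qed.

(** The last link [(u, d)] of a longest chain at [d] is not under the edge [(a, d)], so [u] lies
    left of [a] and the rest of the chain serves [a]. *)
Let block_edge a d : E a d -> (block d <= (block a).+1)%N.
Proof.
move=> Ead; have := blockP d; case: (block d) => //= m.
case/existsP=> u /and3P[ud nG cu]; rewrite ltnS; apply: block_max.
apply: chain_le cu; rewrite leNgt; apply: contra nG => /ltW au.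
by apply/existsP; exists a; apply/existsP; exists d; rewrite Ead au lexx.
Qed.

(** A surviving edge [(b, c)] has [t] longer edges at each end. Their other ends form a [K_{t,t}] by
    crossing, since points of one block lie under a common edge. *)
Lemma card_same_block :
  (#|[set p : T * T | E p.1 p.2 && (block p.1 == block p.2)]| <= t * #|T| + t * #|T|)%N.
Proof.
pose S a d := E a d && (block a == block d).
pose S1 a d := S a d && (#|[set d' | S a d' & (k d < k d')%R]| < t)%N.
pose S2 a d := S a d && (#|[set a' | S a' d & (k a' < k a)%R]| < t)%N.
have sub : [set p : T * T | S p.1 p.2] \subset
    [set p : T * T | S1 p.1 p.2] :|: [set p : T * T | S2 p.1 p.2].
  apply/subsetP => -[b c]; rewrite !inE /= /S1 /S2 => Sbc; rewrite Sbc /=.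
  apply: contraT; rewrite negb_or -!leqNgt => /andP[/card_subset_eq[D sD cD]].
  case/card_subset_eq => A sA cA; case: Ktt_free; exists A, D; split=> // a d.
  move=> /(subsetP sA); rewrite inE => /andP[/andP[Eac /eqP bac] ab].
  move=> /(subsetP sD); rewrite inE => /andP[/andP[Ebd /eqP bbd] cd].
  have bc : k b < k c by case/andP: Sbc => /ltE.
  have /existsP[e /existsP[f /and3P[Eef ea df]]] : G a d.
    apply: block_eq_G; first by rewrite (lt_trans ab) // (lt_trans bc).
    by case/andP: Sbc => _ /eqP bbc; rewrite bac -bbc.
  by apply: (crossE Eac Ebd Eef); rewrite ?ea ?ab ?cd ?df.
apply: leq_trans (subset_leq_card sub) _.
apply: leq_trans (leq_card_setU _ _) _; rewrite leq_add //.
  apply: card_pairs_le => a.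
  have /(card_few_above t) : {in [set d | S a d] &, injective k}.
    by move=> x y; rewrite !inE => /andP[Ex _] /andP[Ey _]; apply: injr Ex Ey.
  congr (_ <= _)%N; congr #|pred_of_set _|; apply/setP => x.
  rewrite !inE /S1; congr (_ && (_ < _)%N).
  by congr #|pred_of_set _|; apply/setP => y; rewrite !inE.
apply: card_pairs_le_r => d.
have /(card_few_above t) : {in [set a | S a d] &, injective (fun x => - k x)}.
  by move=> x y; rewrite !inE => /andP[Ex _] /andP[Ey _] /oppr_inj; apply: injl Ex Ey.
congr (_ <= _)%N; congr #|pred_of_set _|; apply/setP => x.
rewrite !inE /S2; congr (_ && (_ < _)%N).
by congr #|pred_of_set _|; apply/setP => y; rewrite !inE ltrN2.
Qed.

Lemma card_next_block :
  (#|[set p : T * T | E p.1 p.2 && (block p.2 == (block p.1).+1)]|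
     <= t.+1 * (t.+1 * (#|T| + #|T|)))%N.
Proof.
rewrite (card_pairs_swap (fun a d => E a d && (block d == (block a).+1))).
apply: (card_crossing_closed (kI := k) (kJ := k)
  (E := fun d a => E a d && (block d == (block a).+1))) => //.
- by move=> x y a b /andP[Ex _] /andP[Ey _]; apply: injr Ex Ey.
- by move=> x y a b /andP[Ex _] /andP[Ey _]; apply: injl Ex Ey.
- move=> c d f a b e /andP[Eac /eqP bc] /andP[Ebd /eqP bd] /andP[Eef /eqP bf].
  move=> /andP[cd df] /andP[ea ab].
  (* Monotone block numbers squeeze [a], [b] and [e] into one block; [c] is in the next one, whence
     [k b < k c]. *)
  have := (block_le (ltW cd), block_le df, block_le ea, block_le (ltW ab)).
  rewrite bc bd bf !ltnS => -[[[l1 l2] l3] l4].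
  have eab : block a = block b by lia.
  rewrite eab eqxx andbT; apply: (crossE Eac Ebd Eef); rewrite ?ea ?ab ?cd ?df //.
  rewrite ltNge; apply/negP => /block_le; lia.
- case=> A [B [cA cB AB]]; case: Ktt_free; exists B, A; split=> // a b Ba Ab.
  by case/andP: (AB _ _ Ab Ba).
Qed.

Lemma card_nested_crossing :
  (#|[set p : T * T | E p.1 p.2]| <= (t + t + t.+1 * t.+1 * 2) * #|T|)%N.
Proof.
have sub : [set p : T * T | E p.1 p.2] \subset
    [set p : T * T | E p.1 p.2 && (block p.1 == block p.2)] :|:
    [set p : T * T | E p.1 p.2 && (block p.2 == (block p.1).+1)].
  apply/subsetP => -[a d]; rewrite !inE /= => Ead; rewrite Ead /=.
  by move: (block_edge Ead) (block_le (ltW (ltE Ead))); lia.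
apply: leq_trans (subset_leq_card sub) _.
apply: leq_trans (leq_card_setU _ _) _.
apply: leq_trans (leq_add card_same_block card_next_block) _.
nia.
Qed.

End NestedCrossing.

Local Open Scope classical_set_scope.

(** * Visibility in a strip *)

Section Segments.
Variable R : realType.
Implicit Types a b z : (R * R)%type.

Lemma segment_slope a b : a.1 < b.1 ->
  exists m, b.2 = a.2 + m * (b.1 - a.1) /\
    forall z, segment a b z <-> (a.1 <= z.1 <= b.1 /\ z.2 = a.2 + m * (z.1 - a.1)).
Proof.
move=> ab; have d0 : b.1 - a.1 != 0 by rewrite subr_eq0 gt_eqF.
exists ((b.2 - a.2) / (b.1 - a.1)); split; first by rewrite divfK //; lra.
move=> z; split=> [[l /andP[l0 l1] ->]/=|[/andP[az zb] z2]].
  split; first by apply/andP; split; nra.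
  have -> : (1 - l) * a.1 + l * b.1 - a.1 = l * (b.1 - a.1) by lra.
  by rewrite mulrCA divfK //; lra.
exists ((z.1 - a.1) / (b.1 - a.1)).
  by rewrite divr_ge0 ?ler_pdivrMr /=; lra.
rewrite [LHS]surjective_pairing z2; set l := (z.1 - a.1) / (b.1 - a.1).
have lE : l * (b.1 - a.1) = z.1 - a.1 by rewrite divfK.
have -> : (b.2 - a.2) / (b.1 - a.1) * (z.1 - a.1) = l * (b.2 - a.2).
  by rewrite [RHS]mulrC mulrA mulrAC.
by congr pair; lra.
Qed.

Lemma segmentC a b : segment a b = segment b a.
Proof.
apply/seteqP; split=> z [l l01 ->]; exists (1 - l);
  [lra | by congr pair; lra | lra | by congr pair; lra].
Qed.

Lemma segment_left a b : segment a b a.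
Proof. by exists 0; [lra | rewrite [LHS]surjective_pairing; congr pair; lra]. Qed.

Lemma segment_right a b : segment a b b.
Proof. by rewrite segmentC; apply: segment_left. Qed.

Lemma segment_sub a b c z : segment a b c -> segment c b z -> segment a b z.
Proof.
move=> [l l01 ->] [s s01 ->] /=; exists (1 - (1 - s) * (1 - l)); first nra.
by congr pair; lra.
Qed.

End Segments.

Section Strip.
Variable R : realType.
Notation pt := (R * R)%type.

(** The floor is encoded by the set [lo] of points at or above it and the ceiling by the set [hi] of
    points at or below it, so a reflection exchanges them. *)
Definition upward_closed (lo : set pt) :=
  forall z w : pt, lo z -> z.1 = w.1 -> z.2 <= w.2 -> lo w.
Definition downward_closed (hi : set pt) :=
  forall z w : pt, hi z -> z.1 = w.1 -> w.2 <= z.2 -> hi w.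
Definition strip_sees (lo hi : set pt) (a b : pt) := segment a b `<=` lo `&` hi.
Definition floor_point (lo : set pt) (b : pt) :=
  forall z : pt, lo z -> z.1 = b.1 -> b.2 <= z.2.
Definition ceil_point (hi : set pt) (b : pt) :=
  forall z : pt, hi z -> z.1 = b.1 -> z.2 <= b.2.

(** As [b] is below [ac] and [c] below [bd], the slope of [ad] lies between theirs: [ad] is above
    [ac] up to [c] and above [bd] from there on. Both [a] and [d] are below [ef], which keeps [ad]
    below the ceiling. *)
Lemma floor_crossing (lo hi : set pt) (a b c d e f : pt) :
  upward_closed lo -> downward_closed hi ->
  floor_point lo a -> floor_point lo b -> floor_point lo c -> floor_point lo d ->
  strip_sees lo hi a c -> strip_sees lo hi b d -> strip_sees lo hi e f ->
  e.1 <= a.1 < b.1 -> b.1 < c.1 -> c.1 < d.1 <= f.1 -> strip_sees lo hi a d.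
Proof.
move=> lo_up hi_dn Fa Fb Fc Fd ac bd ef /andP[ea ab] bc /andP[cd df].
have [m1 [c2 acP]] := segment_slope (lt_trans ab bc).
have [m2 [d2 bdP]] := segment_slope (lt_trans bc cd).
have [|m [d2' adP]] := @segment_slope _ a d; first by lra.
have [|M [f2 efP]] := @segment_slope _ e f; first by lra.
have ac_pt x : a.1 <= x <= c.1 -> lo (x, a.2 + m1 * (x - a.1)).
  by move=> xP; case: (ac (x, a.2 + m1 * (x - a.1))) => //; apply/acP.
have bd_pt x : b.1 <= x <= d.1 -> lo (x, b.2 + m2 * (x - b.1)).
  by move=> xP; case: (bd (x, b.2 + m2 * (x - b.1))) => //; apply/bdP.
have ef_pt x : e.1 <= x <= f.1 -> (lo `&` hi) (x, e.2 + M * (x - e.1)).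
  by move=> xP; apply: ef; apply/efP.
have b_le : b.2 <= a.2 + m1 * (b.1 - a.1).
  by apply: (Fb _ (ac_pt b.1 _)) => //; lra.
have c_le : c.2 <= b.2 + m2 * (c.1 - b.1).
  by apply: (Fc _ (bd_pt c.1 _)) => //; lra.
have a_le : a.2 <= e.2 + M * (a.1 - e.1).
  by have [|/Fa h _] := ef_pt a.1; [lra | apply: h].
have d_le : d.2 <= e.2 + M * (d.1 - e.1).
  by have [|/Fd h _] := ef_pt d.1; [lra | apply: h].
have m12 : m1 <= m2.
  have : m1 * (c.1 - b.1) <= m2 * (c.1 - b.1) by lra.
  by rewrite ler_pM2r //; lra.
have m1m : m1 <= m.
  have : m1 * (d.1 - a.1) <= m * (d.1 - a.1) by nra.
  by rewrite ler_pM2r //; lra.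
have mm2 : m <= m2.
  have : m * (d.1 - a.1) <= m2 * (d.1 - a.1) by nra.
  by rewrite ler_pM2r //; lra.
move=> z /adP[/andP[az zd] z2]; split.
  case: (leP z.1 c.1) => zc.
    apply: lo_up (ac_pt z.1 _) _ _ => //=; first by rewrite az zc.
    by rewrite z2; nra.
  apply: lo_up (bd_pt z.1 _) _ _ => //=; first by rewrite zd andbT; lra.
  have : 0 <= (m2 - m) * (d.1 - z.1) by apply: mulr_ge0; lra.
  by rewrite z2; lra.
have [|_ hiz] := ef_pt z.1; first by lra.
apply: hi_dn hiz _ _ => //=; rewrite z2.
(* The difference of the two lines is affine and nonnegative at both ends. *)
have : 0 <= (d.1 - z.1) * (e.2 + M * (a.1 - e.1) - a.2)
         + (z.1 - a.1) * (e.2 + M * (d.1 - e.1) - d.2).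
  by apply: addr_ge0; apply: mulr_ge0; lra.
have -> : (d.1 - z.1) * (e.2 + M * (a.1 - e.1) - a.2)
         + (z.1 - a.1) * (e.2 + M * (d.1 - e.1) - d.2) =
         (d.1 - a.1) * (e.2 + M * (z.1 - e.1) - (a.2 + m * (z.1 - a.1))).
  rewrite d2'; lra.
by rewrite pmulr_rge0 ?subr_ge0 //; lra.
Qed.

(** The segment [u'l] is above [ul], with which it shares [l], and below [u'l'], with which it
    shares [u']. *)
Lemma ceil_floor_crossing (lo hi : set pt) (u u' l l' : pt) :
  upward_closed lo -> downward_closed hi ->
  ceil_point hi u' -> floor_point lo l ->
  strip_sees lo hi u l -> strip_sees lo hi u' l' ->
  u.1 < u'.1 -> u'.1 <= l.1 -> l.1 < l'.1 -> strip_sees lo hi u' l.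
Proof.
move=> lo_up hi_dn Cu' Fl ul ul' uu u'l ll.
have [|m1 [l2 ulP]] := @segment_slope _ u l; first by lra.
have [|m2 [l2' ulP']] := @segment_slope _ u' l'; first by lra.
have ul_pt x : u.1 <= x <= l.1 -> (lo `&` hi) (x, u.2 + m1 * (x - u.1)).
  by move=> xP; apply: ul; apply/ulP.
have ul_pt' x : u'.1 <= x <= l'.1 -> (lo `&` hi) (x, u'.2 + m2 * (x - u'.1)).
  by move=> xP; apply: ul'; apply/ulP'.
have u'_ge : u.2 + m1 * (u'.1 - u.1) <= u'.2.
  by have [|_ /Cu'] := ul_pt u'.1; [lra | apply].
have l_le : l.2 <= u'.2 + m2 * (l.1 - u'.1).
  by have [|/Fl h _] := ul_pt' l.1; [lra | apply: h].
move=> z [s /andP[s0 s1] zE].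
have z1 : z.1 = (1 - s) * u'.1 + s * l.1 by rewrite zE.
have z2 : z.2 = (1 - s) * u'.2 + s * l.2 by rewrite zE.
have zP : u'.1 <= z.1 <= l.1 by rewrite z1; nra.
have [|loz _] := ul_pt z.1; first by lra.
have [|_ hiz] := ul_pt' z.1; first by lra.
split.
  apply: lo_up loz _ _ => //=.
  have : 0 <= (1 - s) * (u'.2 - (u.2 + m1 * (u'.1 - u.1))) by apply: mulr_ge0; lra.
  by rewrite z1 z2 l2; lra.
apply: hi_dn hiz _ _ => //=.
have : 0 <= s * (u'.2 + m2 * (l.1 - u'.1) - l.2) by apply: mulr_ge0; lra.
by rewrite z1 z2; lra.
Qed.

(** The two reflections yield the dual and the mirror image of these rules. *)
Let flipy (z : pt) : pt := (z.1, - z.2).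
Let flipx (z : pt) : pt := (- z.1, z.2).

Let flipy_segment a b z : segment a b z -> segment (flipy a) (flipy b) (flipy z).
Proof. by move=> [l l01 ->]; exists l => //; congr pair => /=; lra. Qed.

Let flipx_segment a b z : segment a b z -> segment (flipx a) (flipx b) (flipx z).
Proof. by move=> [l l01 ->]; exists l => //; congr pair => /=; lra. Qed.

Let flipyK : involutive flipy.
Proof. by case=> x y; rewrite /flipy /= opprK. Qed.

Let flipxK : involutive flipx.
Proof. by case=> x y; rewrite /flipx /= opprK. Qed.

Lemma ceil_crossing (lo hi : set pt) (a b c d e f : pt) :
  upward_closed lo -> downward_closed hi ->
  ceil_point hi a -> ceil_point hi b -> ceil_point hi c -> ceil_point hi d ->
  strip_sees lo hi a c -> strip_sees lo hi b d -> strip_sees lo hi e f ->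
  e.1 <= a.1 < b.1 -> b.1 < c.1 -> c.1 < d.1 <= f.1 -> strip_sees lo hi a d.
Proof.
move=> lo_up hi_dn Ca Cb Cc Cd ac bd ef ab bc cd.
pose lo' z := hi (flipy z); pose hi' z := lo (flipy z).
have flipF x : ceil_point hi x -> floor_point lo' (flipy x).
  by move=> Cx z /Cx h /= /h /=; lra.
have flipS x y : strip_sees lo hi x y -> strip_sees lo' hi' (flipy x) (flipy y).
  by move=> xy z /flipy_segment; rewrite !flipyK => /xy[].
have : strip_sees lo' hi' (flipy a) (flipy d).
  apply: (@floor_crossing _ _ _ (flipy b) (flipy c) _ (flipy e) (flipy f));
    [| | exact: flipF.. | exact: flipS | exact: flipS | exact: flipS | | |] => //.
  - by move=> z w hz zw zw2; apply: hi_dn hz _ _ => //=; lra.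
  - by move=> z w hz zw zw2; apply: lo_up hz _ _ => //=; lra.
by move=> ad z /flipy_segment /ad []; rewrite /lo' /hi' !flipyK.
Qed.

Lemma floor_ceil_crossing (lo hi : set pt) (u u' l l' : pt) :
  upward_closed lo -> downward_closed hi ->
  ceil_point hi u' -> floor_point lo l ->
  strip_sees lo hi u l -> strip_sees lo hi u' l' ->
  u'.1 < u.1 -> l.1 <= u'.1 -> l'.1 < l.1 -> strip_sees lo hi u' l.
Proof.
move=> lo_up hi_dn Cu Fl ul ul' uu u'l ll.
pose lo' z := lo (flipx z); pose hi' z := hi (flipx z).
have flipS x y : strip_sees lo hi x y -> strip_sees lo' hi' (flipx x) (flipx y).
  by move=> xy z /flipx_segment; rewrite !flipxK => /xy[].
have : strip_sees lo' hi' (flipx u') (flipx l).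
  apply: (@ceil_floor_crossing _ _ (flipx u) _ _ (flipx l')) => /=;
    [| | | | exact: flipS | exact: flipS | lra..].
  - by move=> z w hz zw zw2; apply: lo_up hz _ _ => //=; lra.
  - by move=> z w hz zw zw2; apply: hi_dn hz _ _ => //=; lra.
  - by move=> z /Cu h /= zx; apply: h => /=; lra.
  - by move=> z /Fl h /= zx; apply: h => /=; lra.
by move=> ad z /flipx_segment /ad []; rewrite /lo' /hi' !flipxK.
Qed.

End Strip.

(** * The boundary and the exterior of a monotone polygon *)

Lemma neq_modD (n i d : nat) : (0 < d < n)%N -> ((i + d) %% n != i %% n)%N.
Proof.
case/andP=> d0 dn; rewrite -[X in (_ != X %% _)%N]addn0 eqn_modDl.
by rewrite mod0n modn_small // -lt0n.
Qed.

Section MonotonePolygon.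
Variables (R : realType) (p : seq (R * R)).
Hypothesis simple_p : simple_polygon p.
Hypothesis mono_p : x_monotone p.
Notation pt := (R * R)%type.

Let m_ge3 : (3 <= size p)%N. Proof. by case: simple_p. Qed.

Lemma vertex_mod i : vertex p (i %% size p) = vertex p i.
Proof. by rewrite /vertex modn_mod. Qed.

Lemma vertex_modS i : vertex p (i %% size p).+1 = vertex p i.+1.
Proof. by rewrite /vertex -addn1 modnDml addn1. Qed.

Lemma pedge_mod i : pedge p (i %% size p) = pedge p i.
Proof. by rewrite /pedge vertex_mod vertex_modS. Qed.

Lemma pedge_boundary i z : pedge p i z -> pboundary p z.
Proof.
move=> ez; exists (i %% size p)%N; rewrite ?pedge_mod //=.
by rewrite ltn_mod; apply: leq_trans m_ge3.
Qed.

Lemma pedge_common i j z : (i %% size p != j %% size p)%N ->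
  pedge p i z -> pedge p j z -> z = vertex p i \/ z = vertex p i.+1.
Proof.
move=> neij; have [_ _ adj far] := simple_p.
rewrite -(pedge_mod i) -(pedge_mod j) -(vertex_modS i) -(vertex_mod i).
have m0 : (0 < size p)%N by apply: leq_trans m_ge3.
move: (ltn_pmod i m0) (ltn_pmod j m0) neij.
move: (i %% size p)%N (j %% size p)%N => {}i {}j lti ltj neij ezi ezj.
have [jE|njE] := eqVneq j (i.+1 %% size p)%N.
  right; move: ezj; rewrite jE pedge_mod => ezj.
  by have : (pedge p i `&` pedge p i.+1) z by []; rewrite adj.
have [iE|niE] := eqVneq i (j.+1 %% size p)%N.
  left; move: ezi; rewrite [in X in X -> _]iE pedge_mod => ezi.
  have : (pedge p j `&` pedge p j.+1) z by [].
  by rewrite adj // iE vertex_mod.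
have : (pedge p i `&` pedge p j) z by [].
by rewrite far.
Qed.

(** The ends and the midpoint of a vertical edge would be three boundary points on one vertical
    line. *)
Lemma vertex_nonvertical i : (vertex p i).1 != (vertex p i.+1).1.
Proof.
have [_ uniq_p _ _] := simple_p.
have m0 : (0 < size p)%N by apply: leq_trans m_ge3.
have neV : vertex p i != vertex p i.+1.
  rewrite /vertex nth_uniq ?ltn_pmod // eq_sym -addn1 neq_modD //=.
  exact: leq_trans m_ge3.
apply/eqP => eq1.
set a := vertex p i in neV eq1 *; set b := vertex p i.+1 in neV eq1 *.
pose c : pt := (a.1, (a.2 + b.2) / 2).
have ec : pedge p i c.
  exists 2^-1; first by apply/andP; split; lra.
  by rewrite /c -/a -/b; congr pair; rewrite -?eq1; lra.
have bda := pedge_boundary (segment_left _ _ : pedge p i a).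
have bdb := pedge_boundary (segment_right _ _ : pedge p i b).
have ne2 : a.2 <> b.2.
  move=> eq2; case/eqP: neV; rewrite [LHS]surjective_pairing [RHS]surjective_pairing.
  by rewrite eq1 eq2.
have [//||] := mono_p bda bdb (pedge_boundary ec) erefl (esym eq1) erefl.
- by move=> e; case: ne2; rewrite e.
- by move/(congr1 snd) => /= e; case: ne2; lra.
- by move/(congr1 snd) => /= e; case: ne2; lra.
Qed.

Lemma pedge_inj i z w : pedge p i z -> pedge p i w -> z.1 = w.1 -> z = w.
Proof.
have := vertex_nonvertical i.
rewrite /pedge; set a := vertex p i; set b := vertex p i.+1 => neab.
move=> [l _ ->] [s _ ->] /= eq1; suff -> : l = s by [].
have : (l - s) * (b.1 - a.1) == 0 by apply/eqP; lra.
rewrite mulf_eq0 => /orP[|]; rewrite subr_eq0 => /eqP // eqab.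
by rewrite eqab eqxx in neab.
Qed.

(** An intermediate value property; the sign of [s] lets left and right be treated at once. *)
Lemma pedge_at i x (s : R) : s * ((vertex p i).1 - x) <= 0 <= s * ((vertex p i.+1).1 - x) \/
    s * ((vertex p i.+1).1 - x) <= 0 <= s * ((vertex p i).1 - x) ->
  s != 0 -> exists2 z, pedge p i z & z.1 = x.
Proof.
have := vertex_nonvertical i.
rewrite /pedge; set a := vertex p i; set b := vertex p i.+1 => neab.
have nz : b.1 - a.1 != 0 by rewrite subr_eq0 eq_sym.
move=> sP s0; pose l := (x - a.1) / (b.1 - a.1).
have lE : l * (b.1 - a.1) = x - a.1 by rewrite divfK.
have nz' : s * (b.1 - a.1) != 0 by rewrite mulf_neq0.
have e1 : l * (s * (b.1 - a.1)) = - (s * (a.1 - x)).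
  by rewrite mulrCA lE; lra.
exists ((1 - l) * a.1 + l * b.1, (1 - l) * a.2 + l * b.2); last by rewrite /=; lra.
exists l => //; apply/andP.
move: nz'; rewrite neq_lt => /orP[neg|pos].
  have -> : l = (s * (a.1 - x)) / - (s * (b.1 - a.1)).
    by rewrite invrN mulrN -mulNr -e1 mulfK // lt_eqF.
  by split; [apply: divr_ge0; lra | rewrite ler_pdivrMr; lra].
have -> : l = (- (s * (a.1 - x))) / (s * (b.1 - a.1)).
  by rewrite -e1 mulfK // gt_eqF.
by split; [apply: divr_ge0; lra | rewrite ler_pdivrMr; lra].
Qed.

(* If the two edges at [vertex p k.+1] leave to the same side and the vertical line
   through it met the boundary elsewhere, then a third edge would reach
   to that side, and a nearby vertical line would meet all three. *)
Lemma local_extremum k (s : R) (b : pt) :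
  let c := (vertex p k.+1).1 in
  0 < s * ((vertex p k).1 - c) -> 0 < s * ((vertex p k.+2).1 - c) ->
  pboundary p b -> b.1 = c -> b = vertex p k.+1.
Proof.
move=> c; pose f i := s * ((vertex p i).1 - c).
rewrite -/(f k) -/(f k.+2) => fk fk2 [j /= ltj ejb] b1.
have s0 : s != 0 by apply: contraTneq fk => s0; rewrite /f s0 mul0r ltxx.
apply: contrapT => nb.
have fk1 : f k.+1 = 0 by rewrite /f subrr mulr0.
have fmod i : f (i %% size p)%N = f i by rewrite /f vertex_mod.
have nb_edge i : pedge p i b -> (i %% size p != k %% size p)%N && (i %% size p != k.+1 %% size p)%N.
  move=> eb; apply/andP; split; apply/eqP => eqi; apply: nb;
    move: eb; rewrite -pedge_mod eqi pedge_mod => eb; apply: (pedge_inj eb _ b1).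
    exact: segment_right.
  exact: segment_left.
have [i [nik nik1 fi]] : exists i, [/\ (i %% size p != k %% size p)%N,
    (i %% size p != k.+1 %% size p)%N &
    (0 < f i /\ f i.+1 <= 0) \/ (f i <= 0 /\ 0 < f i.+1)].
  have := nb_edge j ejb => /andP[njk njk1].
  have [l l01 bE] := ejb.
  have fb : (1 - l) * f j + l * f j.+1 = 0.
    have : s * (b.1 - c) = 0 by rewrite b1 subrr mulr0.
    by rewrite bE /= /f; lra.
  case: (ltP 0 (f j)) => [fj|fj].
    exists j; split=> //; left; split => //; rewrite leNgt; apply/negP => fj1.
    move: l01 => /andP[l0 l1]; case: (ltP l 1) => l1'; first by nra.
    have l1E : l = 1 by lra.
    by rewrite l1E in fb; lra.
  case: (ltP 0 (f j.+1)) => [fj1|fj1]; first by exists j; split=> //; right.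
  have [j' fj'] : exists j', f j' < 0.
    case: (ltP (f j) 0) => fj0; first by exists j.
    exists j.+1; rewrite lt_neqAle fj1 andbT; apply/eqP => fj10.
    have fj0' : f j = 0 by lra.
    move: (vertex_nonvertical j) => /eqP[].
    move: fj0' fj10; rewrite /f => /eqP; rewrite mulf_eq0 (negPf s0) /= => /eqP e1 /eqP.
    by rewrite mulf_eq0 (negPf s0) /= => /eqP e2; lra.
  have m0 : (0 < size p)%N by apply: leq_trans m_ge3.
  (* Walking around the polygon from [vertex p k.+2], [r] steps lead to [j']; the first step leaving
     the positive side gives the third edge. *)
  pose r := ((j' + (size p * k.+2 - k.+2)) %% size p)%N.
  have fr : f (k.+2 + r)%N < 0.
    suff -> : f (k.+2 + r)%N = f j' by [].
    rewrite -fmod -[RHS]fmod /r modnDmr addnCA subnKC; last by rewrite leq_pmull.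
    by rewrite mulnC addnC modnMDl.
  have ltr : (r < size p)%N by rewrite ltn_pmod.
  have exP : exists q, f (k.+2 + q)%N <= 0 by exists r; apply: ltW.
  have [q fq minq] := ex_minnP exP.
  have leqr : (q <= r)%N by apply: minq; apply: ltW.
  case: q fq minq leqr => [|q] fq minq leqr; first by move: fq; rewrite addn0; lra.
  have fq0 : 0 < f (k.+2 + q)%N by rewrite ltNge; apply/negP => /minq; rewrite ltnn.
  (* The walk stops before returning to [vertex p k.+1], so its last edge differs from both edges
     there. *)
  have r1 : (r.+1 != size p)%N.
    apply: contraTneq fr => rE; rewrite -leNgt.
    have -> : (k.+2 + r = k.+1 + size p)%N by rewrite -rE addSnnS.
    by rewrite -fmod modnDr fmod fk1.
  have ltq : (q.+2 < size p)%N.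
    by apply: (@leq_ltn_trans r.+1); rewrite ?ltnS // ltn_neqAle r1.
  exists (k.+2 + q)%N; split.
  - by rewrite 2!addSnnS neq_modD.
  - by rewrite addSnnS neq_modD //= ltnW.
  - by left; split=> //; rewrite -addnS.
(* At offset [e / 2] the vertical line meets all three edges. The relevant vertices of edges [k] and
   [k.+1] have offset 0 or at least [e], so the meeting points are not shared vertices and are
   distinct. *)
pose e := Num.min (Num.min (f k) (f k.+2)) (Num.max (f i) (f i.+1)).
have e0 : 0 < e by rewrite !lt_min fk fk2 lt_max; case: fi => -[fi1 fi2]; rewrite ?fi1 ?fi2 ?orbT.
pose x := c + e / 2 / s.
have fx : s * (x - c) = e / 2 by rewrite /x addrC addKr mulrC divfK.
have sx (v : pt) : s * (v.1 - x) = s * (v.1 - c) - e / 2 by rewrite -fx; lra.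
have le1 : e <= f k by rewrite /e !ge_min lexx.
have le2 : e <= f k.+2 by rewrite /e !ge_min lexx orbT.
have le3 : e <= f i \/ e <= f i.+1.
  by apply/orP; rewrite -le_max /e ge_min lexx orbT.
have [|//|z1 ez1 z1x] := @pedge_at k x s.
  by right; rewrite !sx -/(f _) -/(f _); apply/andP; split; lra.
have [|//|z2 ez2 z2x] := @pedge_at k.+1 x s.
  by left; rewrite !sx -/(f _) -/(f _); apply/andP; split; lra.
have [|//|z3 ez3 z3x] := @pedge_at i x s.
  rewrite !sx -/(f i) -/(f i.+1).
  by case: fi le3 => -[fi1 fi2] [] le3; [right|lra|lra|left]; apply/andP; split; lra.
have ne12 : (k %% size p != k.+1 %% size p)%N.
  by rewrite eq_sym -addn1 neq_modD //= (leq_trans _ m_ge3).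
have nv (v : pt) i' : s * (v.1 - c) = e / 2 -> v = vertex p i' -> f i' = e / 2.
  by move=> fv vE; rewrite /f -vE.
have fz1 : s * (z1.1 - c) = e / 2 by rewrite z1x.
have fz2 : s * (z2.1 - c) = e / 2 by rewrite z2x.
have [] := mono_p (pedge_boundary ez1) (pedge_boundary ez2) (pedge_boundary ez3) z1x z2x z3x.
- move=> z12; rewrite -z12 in ez2.
  by have [] := pedge_common ne12 ez1 ez2 => /(nv _ _ fz1); lra.
- move=> z13; rewrite -z13 in ez3; rewrite eq_sym in nik.
  by have [] := pedge_common nik ez1 ez3 => /(nv _ _ fz1); lra.
- move=> z23; rewrite -z23 in ez3; rewrite eq_sym in nik1.
  by have [] := pedge_common nik1 ez2 ez3 => /(nv _ _ fz2); lra.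
Qed.

(** If no edge at [b] reached the side given by [s], then [b] would be a vertex with both edges
    leaving to the other side, and [local_extremum] would give [b' = b]. *)
Lemma boundary_extends (s : R) (b b' : pt) : s != 0 ->
  pboundary p b -> pboundary p b' -> b'.1 = b.1 -> b' <> b ->
  exists i, pedge p i b /\
    exists2 e, pedge p i e & 0 < s * (e.1 - b.1) /\
      segment b e `<=` pedge p i.
Proof.
move=> s0 [i /= _ eib] bd_b' b'1 neb.
suff [j [ejb jP]] : exists j, pedge p j b /\
    (0 < s * ((vertex p j).1 - b.1) \/ 0 < s * ((vertex p j.+1).1 - b.1)).
  exists j; split=> //; case: jP => jP; [exists (vertex p j) | exists (vertex p j.+1)].
  - exact: segment_left.
  - split=> // z; rewrite /pedge (segmentC (vertex p j)); apply: segment_sub.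
    by rewrite segmentC.
  - exact: segment_right.
  - by split=> // z; apply: segment_sub.
pose f j := s * ((vertex p j).1 - b.1).
case: (ltP 0 (f i)) => [fi|fi]; first by exists i; split=> //; left.
case: (ltP 0 (f i.+1)) => [fi1|fi1]; first by exists i; split=> //; right.
have [l /andP[l0 l1] bE] := eib.
have fb : (1 - l) * f i + l * f i.+1 = 0.
  have : s * (b.1 - b.1) = 0 by rewrite subrr mulr0.
  by rewrite {1}bE /= /f; lra.
have vertexE j : f j = 0 -> pedge p i (vertex p j) -> b = vertex p j.
  move/eqP; rewrite mulf_eq0 (negPf s0) /= subr_eq0 => /eqP j1 ej.
  exact: pedge_inj eib ej (esym j1).
have nf0 : f i != f i.+1.
  apply: contraNneq (vertex_nonvertical i) => /(mulfI s0) eqv.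
  by apply/eqP; lra.
have [fi0|fi10] : f i = 0 \/ f i.+1 = 0.
  case: (ltP 0 l) => l0'; [right | left]; nra.
- have bV := vertexE _ fi0 (segment_left _ _).
  (* The cyclic predecessor of [i], written so as to be correct for [i = 0]. *)
  pose k := (i + (size p).-1)%N.
  have k1 : vertex p k.+1 = vertex p i.
    rewrite -vertex_mod /k -addnS prednK ?modnDr ?vertex_mod //.
    exact: leq_trans m_ge3.
  have k2 : vertex p k.+2 = vertex p i.+1.
    rewrite -vertex_mod /k -addnS prednK -?addSn ?modnDr ?vertex_mod //.
    exact: leq_trans m_ge3.
  have ekb : pedge p k b by rewrite bV -k1; apply: segment_right.
  case: (ltP 0 (f k)) => [fk|fk]; first by exists k; split=> //; left.
  case: neb; rewrite bV -k1; apply: (@local_extremum k (- s)) => //.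
  + have := vertex_nonvertical k; rewrite k1 -bV => nv.
    have : f k != 0 by rewrite mulf_neq0 // subr_eq0.
    by move=> fk0; rewrite mulNr oppr_gt0 lt_neqAle fk0.
  + by rewrite k1 k2 -bV mulNr oppr_gt0 lt_neqAle fi1 andbT -fi0 eq_sym.
  + by rewrite b'1 bV k1.
- have bV := vertexE _ fi10 (segment_right _ _).
  have ekb : pedge p i.+1 b by rewrite bV; apply: segment_left.
  case: (ltP 0 (f i.+2)) => [fk|fk]; first by exists i.+1; split=> //; right.
  case: neb; rewrite bV; apply: (@local_extremum i (- s)) => //.
  + by rewrite -bV mulNr oppr_gt0 lt_neqAle fi andbT -fi10.
  + have := vertex_nonvertical i.+1; rewrite -bV => nv.
    have : f i.+2 != 0 by rewrite mulf_neq0 // subr_eq0 eq_sym.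
    by move=> fk0; rewrite mulNr oppr_gt0 lt_neqAle fk0.
  + by rewrite b'1 bV.
Qed.

(* [side 1 z] : some boundary point lies at or below [z] on its vertical
   line; [side (-1) z] : some boundary point lies at or above it. *)
Definition side (s : R) : set pt :=
  [set z | exists b, [/\ pboundary p b, b.1 = z.1 & s * b.2 <= s * z.2]].

(** The boundary continues from [b] along edges to the left and to the right, and by continuity
    these stay strictly on the same side of all points near [z]. *)
Lemma side_near (s : R) (b b' z : pt) : pboundary p b -> pboundary p b' ->
  b.1 = z.1 -> b'.1 = z.1 -> b' <> b -> s * b.2 < s * z.2 ->
  \forall w \near z, side s w.
Proof.
move=> bdb bdb' b1 b'1 neb sb.
have b'b : b'.1 = b.1 by rewrite b'1.
have [|i [_ [e _ [be esub]]]] := @boundary_extends 1 b b' _ bdb bdb' b'b neb.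
  exact: oner_neq0.
have [|j [_ [e' _ [be' esub']]]] := @boundary_extends (-1) b b' _ bdb bdb' b'b neb.
  by rewrite oppr_eq0 oner_neq0.
have lt_e : b.1 < e.1 by lra.
have lt_e' : e'.1 < b.1 by lra.
have [m1 [_ P1]] := segment_slope lt_e.
have [m2 [e'2 P2]] := segment_slope lt_e'.
have cont1 : {for z, continuous (fun w : pt => w.1)} by exact: cvg_fst.
have cont2 : {for z, continuous (fun w : pt => w.2)} by exact: cvg_snd.
have contl (mm : R) : {for z, continuous (fun w : pt => s * w.2 - s * (b.2 + mm * (w.1 - b.1)))}.
  apply: cvgB; first by apply: cvgM; [exact: cvg_cst | exact: cont2].
  apply: cvgM; first exact: cvg_cst.
  apply: cvgD; first exact: cvg_cst.
  apply: cvgM; first exact: cvg_cst.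
  by apply: cvgB; [exact: cont1 | exact: cvg_cst].
have near1 mm : \forall w \near z, 0 < s * w.2 - s * (b.2 + mm * (w.1 - b.1)).
  apply: (cvgr_gt _ (contl mm)).
  by rewrite b1 subrr mulr0 addr0 subr_gt0.
near=> w.
have w1 : w.1 < e.1.
  by near: w; apply: (cvgr_lt _ cont1); rewrite -b1.
have w2 : e'.1 < w.1.
  by near: w; apply: (cvgr_gt _ cont1); rewrite -b1.
have w3 : 0 < s * w.2 - s * (b.2 + m1 * (w.1 - b.1)) by near: w; apply: near1.
have w4 : 0 < s * w.2 - s * (b.2 + m2 * (w.1 - b.1)) by near: w; apply: near1.
case: (leP b.1 w.1) => bw.
  exists (w.1, b.2 + m1 * (w.1 - b.1)); split=> //=; last by lra.
  by apply: (@pedge_boundary i); apply: esub; apply/P1; split=> //=; lra.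
exists (w.1, b.2 + m2 * (w.1 - b.1)); split=> //=; last by lra.
apply: (@pedge_boundary j); apply: esub'; rewrite segmentC; apply/P2.
by split=> /=; [lra | rewrite e'2; lra].
Unshelve. all: by end_near. Qed.

End MonotonePolygon.

(** * The exterior as the complement of a closed bounded strip *)

Lemma closed_segment_side (R : realType) (s : R) (a b : R * R) : a.1 < b.1 ->
  closed [set z : R * R | exists c, [/\ segment a b c, c.1 = z.1 & s * c.2 <= s * z.2]].
Proof.
move=> ab; have [m [_ abP]] := segment_slope ab.
pose f (z : R * R) := s * z.2 - s * (a.2 + m * (z.1 - a.1)).
have cont1 : continuous (fun w : R * R => w.1) by move=> z; exact: cvg_fst.
have cont2 : continuous (fun w : R * R => w.2) by move=> z; exact: cvg_snd.
have contf : continuous f.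
  move=> z; apply: cvgB; first by apply: cvgM; [exact: cvg_cst | exact: cont2].
  apply: cvgM; first exact: cvg_cst.
  apply: cvgD; first exact: cvg_cst.
  apply: cvgM; first exact: cvg_cst.
  by apply: cvgB; [exact: cont1 | exact: cvg_cst].
(* Three weak inequalities between continuous functions cut out this set. *)
have -> : [set z | exists c, [/\ segment a b c, c.1 = z.1 & s * c.2 <= s * z.2]] =
    ((fun w : R * R => w.1) @^-1` [set x | a.1 <= x]) `&`
    (((fun w : R * R => w.1) @^-1` [set x | x <= b.1]) `&` (f @^-1` [set x | 0 <= x])).
  apply/seteqP; split=> [z [c [/abP[/andP[ac cb] c2] cz]]|z [/= az [/= zb fz]]] /=.
    by move=> le; rewrite -cz; split=> //; split=> //; rewrite /f -cz -c2 subr_ge0.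
  exists (z.1, a.2 + m * (z.1 - a.1)); split=> //=; last by rewrite -subr_ge0.
  by apply/abP; rewrite /= az zb.
apply: closedI; first by move/continuous_closedP: cont1; apply; exact: closed_ge.
apply: closedI; first by move/continuous_closedP: cont1; apply; exact: closed_le.
by move/continuous_closedP: contf; apply; exact: closed_ge.
Qed.

Section Exterior.
Variables (R : realType) (p : seq (R * R)).
Hypothesis simple_p : simple_polygon p.
Hypothesis mono_p : x_monotone p.
Notation pt := (R * R)%type.

Lemma closed_side (s : R) : closed (side p s).
Proof.
have -> : side p s = \bigcup_(i in [set i : nat | (i < size p)%N])
    [set z | exists c, [/\ pedge p i c, c.1 = z.1 & s * c.2 <= s * z.2]].
  apply/seteqP; split=> [z [b [[i lti eib] bz sb]]|z [i lti [b [eib bz sb]]]].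
    by exists i => //; exists b.
  by exists b; split=> //; exists i.
apply: closed_bigcup => [|i _]; first exact: finite_II.
have := vertex_nonvertical simple_p mono_p i; rewrite neq_lt => /orP[lt|lt].
  exact: closed_segment_side.
by rewrite /pedge segmentC; apply: closed_segment_side.
Qed.

Let strip : set pt := side p 1 `&` side p (-1).

Lemma boundary_side s : pboundary p `<=` side p s.
Proof. by move=> b bdb; exists b. Qed.

(** Off the boundary, the boundary points below and above [z] are strictly so, hence distinct, and
    [side_near] applies to each. *)
Lemma strip_interior : strip `\` pboundary p `<=` strip^°.
Proof.
move=> z [[[b [bdb b1 bz]] [b' [bdb' b'1 zb']]] nbd].
have neq (c : pt) : pboundary p c -> c.1 = z.1 -> c.2 != z.2.
  move=> bdc c1; apply/eqP => c2; apply: nbd.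
  by rewrite [z]surjective_pairing -c1 -c2 -surjective_pairing.
have ltb : b.2 < z.2 by rewrite lt_neqAle neq //; lra.
have ltb' : z.2 < b'.2 by rewrite lt_neqAle eq_sym neq //; lra.
have ne1 : b' <> b by move=> e; rewrite e in ltb'; lra.
have ne2 : b <> b' by move=> e; apply: ne1.
have lo_z : \forall w \near z, side p 1 w.
  by apply: (side_near simple_p mono_p bdb bdb') => //; rewrite !mul1r.
have hi_z : \forall w \near z, side p (-1) w.
  by apply: (side_near simple_p mono_p bdb' bdb) => //; rewrite !mulN1r ltrN2.
by near=> w; split; near: w.
Unshelve. all: by end_near. Qed.

Lemma strip_bounded : exists M : R, forall z, strip z -> `|z.1| + `|z.2| <= M.
Proof.
pose N : R := \sum_(q <- p) (`|q.1| + `|q.2|).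
have m0 : (0 < size p)%N by case: simple_p => m3 _ _ _; apply: leq_trans m3.
have vN i : `|(vertex p i).1| + `|(vertex p i).2| <= N.
  have vp : vertex p i \in p by rewrite mem_nth // ltn_pmod.
  rewrite /N (big_rem _ vp) /= lerDl; apply: sumr_ge0 => q _.
  exact: addr_ge0.
have combN (l x y : R) : 0 <= l <= 1 -> `|x| <= N -> `|y| <= N -> `|(1 - l) * x + l * y| <= N.
  by move=> l01; rewrite !ler_norml => /andP[x1 x2] /andP[y1 y2]; apply/andP; split; nra.
have le1 i : `|(vertex p i).1| <= N by apply: le_trans (vN i); rewrite lerDl.
have le2 i : `|(vertex p i).2| <= N by apply: le_trans (vN i); rewrite lerDr.
have bN b : pboundary p b -> `|b.1| <= N /\ `|b.2| <= N.
  by move=> [i _ [l l01 ->]] /=; split; apply: combN.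
exists (N + N) => z [[b [/bN[b1N b2N] b1 bz]] [b' [/bN[_ b2N'] _ bz']]].
rewrite lerD -?b1 //; move: b2N b2N'; rewrite !ler_norml => /andP[x1 x2] /andP[y1 y2].
by apply/andP; split; lra.
Qed.

(** Along a path avoiding the boundary, the times spent in the strip form an open and closed subset
    of [[0, 1]], so the path stays in this bounded set. Conversely, a point outside the strip
    escapes vertically. *)
Lemma exteriorP z : pexterior p z <-> ~ strip z.
Proof.
split.
  case=> nbd far [lo_z hi_z].
  have [M MP] := strip_bounded.
  have [g [contg g0 gM gbd]] := far M.
  pose S := `[0, 1]%classic `&` g @^-1` strip.
  have S01 : S = `[0, 1]%classic.
    apply: (@segment_connected R 0 1 S).
    - by exists 0; split; rewrite /= ?g0 // in_itv /= lexx ler01.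
    - exists (g @^-1` strip^°).
        by move/continuousP: contg; apply; exact: open_interior.
      apply/seteqP; split=> [x [x01 gx]|x [x01 gx]]; split=> //.
        by apply: strip_interior; split=> //; apply: gbd; move: x01; rewrite /= in_itv.
      exact: interior_subset gx.
    - exists (g @^-1` strip) => //.
      move/continuous_closedP: contg; apply.
      by apply: closedI; exact: closed_side.
  have [_ g1] : S 1 by rewrite S01 /= in_itv /= lexx ler01.
  by have := MP _ g1; rewrite leNgt gM.
move=> nz; split=> [bdz|M]; first by apply: nz; split; apply: boundary_side.
(* [s] is the free direction: 1 for up, -1 for down. *)
have [s [s2 ns]] : exists s : R, `|s| = 1 /\ ~ side p (- s) z.
  move/not_andP: nz => [nlo|nhi]; [exists (-1) | exists 1].
    by rewrite normrN1 opprK.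
  by rewrite normr1.
have ss : s * s = 1.
  by have := real_normK (num_real s); rewrite s2 expr1n expr2.
(* Large enough that moving by [K] beats both the height of [z] and [M]. *)
pose K := `|z.2| + `|M| + 1.
have K0 : 0 <= K by rewrite /K !addr_ge0.
exists (fun x : R => (z.1, z.2 + x * (s * K))); split.
- move=> x; apply: (@cvg_pair _ _ _ (nbhs x) (nbhs z.1) (nbhs (z.2 + x * (s * K)))).
    exact: cvg_cst.
  apply: cvgD; first exact: cvg_cst.
  by apply: cvgM; [exact: cvg_id | exact: cvg_cst].
- by rewrite mul0r addr0 -surjective_pairing.
- rewrite /= mul1r.
  have : `|s * K| <= `|z.2 + s * K| + `|z.2|.
    by have := ler_normB (z.2 + s * K) z.2; rewrite addrC addKr.
  rewrite normrM s2 mul1r (ger0_norm K0) /K.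
  have := ler_norm M; have := normr_ge0 z.1; lra.
- move=> x /andP[x0 _] bdx; apply: ns; exists (z.1, z.2 + x * (s * K)); split=> //=.
  have -> : - s * (z.2 + x * (s * K)) = - s * z.2 - (s * s) * (x * K) by lra.
  by rewrite ss mul1r gerBl mulr_ge0.
Qed.

Lemma seesP a b : sees p a b <-> strip_sees (side p 1) (side p (-1)) a b.
Proof.
split=> [ab z abz|ab].
  apply: contrapT => /exteriorP ext.
  by have : (segment a b `&` pexterior p) z by []; rewrite ab.
by apply/seteqP; split=> // z [/ab sz /exteriorP].
Qed.

Lemma side_upward : upward_closed (side p 1).
Proof.
move=> z w [b [bdb b1 bz]] zw zw2; exists b; split=> //; first by rewrite b1.
by lra.
Qed.

Lemma side_downward : downward_closed (side p (-1)).
Proof.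
move=> z w [b [bdb b1 bz]] zw zw2; exists b; split=> //; first by rewrite b1.
by lra.
Qed.

Lemma floor_point_inj a b : pboundary p a -> pboundary p b ->
  floor_point (side p 1) a -> floor_point (side p 1) b -> a.1 = b.1 -> a = b.
Proof.
move=> bda bdb Fa Fb e1; have ab := Fa b (boundary_side _ bdb) (esym e1).
have ba := Fb a (boundary_side _ bda) e1.
by rewrite [a]surjective_pairing [b]surjective_pairing e1; congr pair; lra.
Qed.

Lemma ceil_point_inj a b : pboundary p a -> pboundary p b ->
  ceil_point (side p (-1)) a -> ceil_point (side p (-1)) b -> a.1 = b.1 -> a = b.
Proof.
move=> bda bdb Fa Fb e1; have ab := Fa b (boundary_side _ bdb) (esym e1).
have ba := Fb a (boundary_side _ bda) e1.
by rewrite [a]surjective_pairing [b]surjective_pairing e1; congr pair; lra.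
Qed.

(** A point that is neither would have boundary points strictly below and strictly above it, three
    on one vertical line. *)
Lemma not_floor_ceil a : pboundary p a ->
  ~ floor_point (side p 1) a -> ceil_point (side p (-1)) a.
Proof.
move=> bda nF z [b [bdb b1 zb]] za; apply: contrapT => /negP; rewrite -ltNge => az.
apply: nF => w [c [bdc c1 cw]] wa; apply: contrapT => /negP; rewrite -ltNge => wa2.
have b1' : b.1 = a.1 by rewrite b1.
have c1' : c.1 = a.1 by rewrite c1.
by have [] := mono_p bda bdb bdc erefl b1' c1' => e; move: zb cw; rewrite -?e; lra.
Qed.

End Exterior.

(* Adding up the four classes of visibility edges *)
Local Close Scope classical_set_scope.

Theorem theorem1p3 (R : realType) (t : nat) : (0 < t)%N ->
  exists C : nat, forall (p : seq (R * R)) (n : nat) (v : 'I_n -> R * R),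
    simple_polygon p -> x_monotone p ->
    injective v -> (forall i, pboundary p (v i)) ->
    ~ contains_Ktt p v t ->
    (#|vis_edges p v| <= C * n)%N.
Proof.
move=> t0.
pose D := ((t + t + t.+1 * t.+1 * 2) + (t + t + t.+1 * t.+1 * 2) +
  (t.+1 * (t.+1 * 2) + t.+1 * (t.+1 * 2)))%N.
(* [D] sums the four class bounds; the doubling pays for the index order of a pair differing from
   its order in its class. *)
exists (D + D)%N => p n v simple_p mono_p inj_v bd_v noKtt.
pose k i := (v i).1.
pose fl i := `[< floor_point (side p 1) (v i) >].
pose vis i j := `[< sees p (v i) (v j) >].
have flP i : fl i -> floor_point (side p 1) (v i) by move/asboolP.
have upP i : ~~ fl i -> ceil_point (side p (-1)) (v i).
  by move/asboolP; apply: not_floor_ceil.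
have visP i j : vis i j -> strip_sees (side p 1) (side p (-1)) (v i) (v j).
  by move/asboolP/seesP; apply.
have visI i j : strip_sees (side p 1) (side p (-1)) (v i) (v j) -> vis i j.
  by move=> ij; apply/asboolP/seesP.
have visC i j : vis i j = vis j i by rewrite /vis /sees segmentC.
have lo_up := @side_upward R p; have hi_dn := @side_downward R p.
have fl_inj i j : fl i -> fl j -> k i = k j -> i = j.
  by move=> /flP Fi /flP Fj e; apply: inj_v; apply: (floor_point_inj (bd_v i) (bd_v j)).
have up_inj i j : ~~ fl i -> ~~ fl j -> k i = k j -> i = j.
  by move=> /upP Fi /upP Fj e; apply: inj_v; apply: (ceil_point_inj (bd_v i) (bd_v j)).
(* Irreflexivity makes the two sides of the complete bipartite graph disjoint, as [contains_Ktt]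
   demands. *)
have noK (E : 'I_n -> 'I_n -> bool) :
    (forall i j, E i j -> vis i j) -> (forall i, ~~ E i i) ->
    ~ exists A B : {set 'I_n},
      [/\ #|A| = t, #|B| = t & forall a b, a \in A -> b \in B -> E a b].
  move=> Evis irr [A [B [cA cB AB]]]; apply: noKtt; exists A, B; split=> //.
    rewrite disjoints_subset; apply/subsetP => i Ai; rewrite inE.
    by apply: contra (irr i) => Bi; apply: AB.
  by move=> a b Aa Bb; apply/asboolP/Evis/AB.
(* Classes by the kinds of the ends and their horizontal order. Distinct points with equal abscissa
   are a floor and a ceiling point, so only [UL] and [LU] allow equality. *)
pose FF i j := [&& fl i, fl j, k i < k j & vis i j].
pose CC i j := [&& ~~ fl i, ~~ fl j, k i < k j & vis i j].
pose UL i j := [&& ~~ fl i, fl j, k i <= k j & vis i j].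
pose LU i j := [&& ~~ fl i, fl j, k j <= k i & vis i j].
have cFF : (#|[set e : 'I_n * 'I_n | FF e.1 e.2]| <= (t + t + t.+1 * t.+1 * 2) * #|'I_n|)%N.
  apply: (@card_nested_crossing R _ k) => //.
  - by move=> a d /and4P[].
  - by move=> a b c d /and4P[Fa _ _ _] /and4P[Fb _ _ _]; apply: fl_inj.
  - by move=> a b c d /and4P[_ Fa _ _] /and4P[_ Fb _ _]; apply: fl_inj.
  - move=> a b c d e f /and4P[Fa Fc _ /visP ac] /and4P[Fb Fd _ /visP bd].
    move=> /and4P[_ _ _ /visP ef] ab bc cd.
    apply/and4P; split=> //; first by move: ab bc cd; lra.
    apply: visI; apply: (floor_crossing lo_up hi_dn _ _ _ _ ac bd ef ab bc cd);
      exact: flP.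
  - by apply: noK => [i j /and4P[]|i] //; rewrite /FF ltxx !andbF.
have cCC : (#|[set e : 'I_n * 'I_n | CC e.1 e.2]| <= (t + t + t.+1 * t.+1 * 2) * #|'I_n|)%N.
  apply: (@card_nested_crossing R _ k) => //.
  - by move=> a d /and4P[].
  - by move=> a b c d /and4P[Fa _ _ _] /and4P[Fb _ _ _]; apply: up_inj.
  - by move=> a b c d /and4P[_ Fa _ _] /and4P[_ Fb _ _]; apply: up_inj.
  - move=> a b c d e f /and4P[Fa Fc _ /visP ac] /and4P[Fb Fd _ /visP bd].
    move=> /and4P[_ _ _ /visP ef] ab bc cd.
    apply/and4P; split=> //; first by move: ab bc cd; lra.
    apply: visI; apply: (ceil_crossing lo_up hi_dn _ _ _ _ ac bd ef ab bc cd);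
      exact: upP.
  - by apply: noK => [i j /and4P[]|i] //; rewrite /CC ltxx !andbF.
have cUL : (#|[set e : 'I_n * 'I_n | UL e.1 e.2]| <= t.+1 * (t.+1 * (#|'I_n| + #|'I_n|)))%N.
  apply: (@card_crossing_closed R _ _ k k) => //.
  - by move=> a b c d /and4P[Fa _ _ _] /and4P[Fb _ _ _]; apply: up_inj.
  - by move=> a b c d /and4P[_ Fa _ _] /and4P[_ Fb _ _]; apply: fl_inj.
  - move=> x x' x'' y y' y'' /and4P[_ Fy _ /visP xy] /and4P[Ux' _ _ /visP xy'].
    move=> /and4P[_ _ xy'' _] /andP[xx xx'] /andP[yy yy'].
    have x'y : k x' <= k y by rewrite (le_trans xx') // (le_trans xy'').
    apply/and4P; split=> //; apply: visI.
    by apply: (ceil_floor_crossing lo_up hi_dn (upP _ Ux') (flP _ Fy) xy xy').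
  - by apply: noK => [i j /and4P[]|i] //; rewrite /UL; case: (fl i).
have cLU : (#|[set e : 'I_n * 'I_n | LU e.1 e.2]| <= t.+1 * (t.+1 * (#|'I_n| + #|'I_n|)))%N.
  (* With the ceiling point on the right, negated abscissas restore the orientation of the first
     rule. *)
  apply: (@card_crossing_closed R _ _ (fun i => - k i) (fun i => - k i)) => //.
  - by move=> a b c d /and4P[Fa _ _ _] /and4P[Fb _ _ _] /oppr_inj; apply: up_inj.
  - by move=> a b c d /and4P[_ Fa _ _] /and4P[_ Fb _ _] /oppr_inj; apply: fl_inj.
  - move=> x x' x'' y y' y'' /and4P[_ Fy _ /visP xy] /and4P[Ux' _ _ /visP xy'].
    move=> /and4P[_ _ xy'' _]; rewrite !ltrN2 !lerN2 => /andP[xx xx'] /andP[yy yy'].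
    have x'y : k y <= k x' by rewrite (le_trans yy) // (le_trans xy'').
    apply/and4P; split=> //; apply: visI.
    by apply: (floor_ceil_crossing lo_up hi_dn (upP _ Ux') (flP _ Fy) xy xy').
  - by apply: noK => [i j /and4P[]|i] //; rewrite /LU; case: (fl i).
pose X := [set e : 'I_n * 'I_n | FF e.1 e.2] :|: [set e : 'I_n * 'I_n | CC e.1 e.2] :|:
  ([set e : 'I_n * 'I_n | UL e.1 e.2] :|: [set e : 'I_n * 'I_n | LU e.1 e.2]).
pose swap (e : 'I_n * 'I_n) := (e.2, e.1).
have swap_inj : injective swap by move=> [a b] [c d] [-> ->].
have cX : (#|X| <= D * n)%N.
  rewrite /X; apply: leq_trans (leq_card_setU _ _) _.
  apply: leq_trans (leq_add (leq_card_setU _ _) (leq_card_setU _ _)) _.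
  apply: leq_trans (leq_add (leq_add cFF cCC) (leq_add cUL cLU)) _.
  by rewrite card_ord /D; clear; nia.
have sub : vis_edges p v \subset X :|: swap @^-1: X.
  apply/subsetP => -[i j]; rewrite !inE /= => /andP[ltij]; rewrite -/(vis i j) => vij.
  have ne_ij : i != j by apply: contraTneq ltij => ->; rewrite ltnn.
  rewrite /FF /CC /UL /LU (visC j i) vij !andbT.
  have := fl_inj i j; have := up_inj i j.
  case: (fl i); case: (fl j) => /=; case: (ltgtP (k i) (k j)) => //= kij H1 H2.
    by case/eqP: ne_ij; apply: H2.
  by case/eqP: ne_ij; apply: H1.
apply: leq_trans (subset_leq_card sub) _.
apply: leq_trans (leq_card_setU _ _) _.
by rewrite mulnDl leq_add // card_preimset.
Qed.
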